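(* Let $R$ be a principal ideal domain which is not a field, and let $M$ be a finitely generated left $R$-module. Then $M$ has a proper essential submodule if and only if the Betti number of $M$ is at least $1$ or some invariant factor of $M$ is not square-free.
   Context: A proper essential submodule of a module $M$ is a submodule $E$ of $M$ with $E\neq\{0_M\}$, $E\neq M$, such that $E\cap N\neq\{0_M\}$ for every nonzero submodule $N$ of $M$. By the fundamental theorem of finitely generated modules over a principal ideal domain, $M\cong R^n\oplus R/\langle a_1\rangle\oplus\cdots\oplus R/\langle a_m\rangle$ with $a_1,\dots,a_m$ nonzero nonunits and $a_1\mid a_2\mid\cdots\mid a_m$; the Betti number of $M$ is the free rank $n$, and $a_1,\dots,a_m$ (unique up to units) are the invariant factors. An element is square-free if it is not divisible by the square of any prime. *)

(* Defs.v *)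
From HB Require Import structures.
From mathcomp Require Import all_boot all_order all_algebra.
From mathcomp Require Import boolp classical_sets.

Set Implicit Arguments.
Unset Strict Implicit.
Unset Printing Implicit Defensive.

Import GRing.Theory.
Local Open Scope ring_scope.
Local Open Scope quotient_scope.
Local Open Scope classical_set_scope.

(* [submodule N] is the library closure predicate applied to the (arbitrary,
   possibly undecidable) subset N: 0 and all a *: u + v stay in N. *)
Definition submodule (R : nzRingType) (M : lmodType R) (N : set M) : Prop :=
  submod_closed (mem N).

Definition proper_essential_submodule (R : nzRingType) (M : lmodType R)
    (E : set M) : Prop :=
  [/\ submodule E, E <> [set 0], E <> setT &
      forall N : set M, submodule N -> N <> [set 0] -> E `&` N <> [set 0]].

Definition finitely_generated (R : nzRingType) (M : lmodType R) : Prop :=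
  exists (k : nat) (g : 'I_k -> M),
    forall x : M, exists c : 'I_k -> R, x = \sum_(i < k) c i *: g i.

Section Divisibility.
Variable R : idomainType.
Implicit Types a p x y : R.

Definition rdvd x y : bool := `[< exists c, y = c * x >].

(* An ideal of R is a submodule of the regular module R^o. *)
Definition is_PID : Prop :=
  forall I : set R^o, submodule I -> exists a : R, I = [set x | rdvd a x].

Definition prime_elt p : Prop :=
  [/\ p != 0, p \isn't a GRing.unit &
      forall x y, rdvd p (x * y) -> rdvd p x \/ rdvd p y].

Definition square_free x : Prop := forall p, prime_elt p -> ~~ rdvd (p ^+ 2) x.

Definition principal_ideal a : {pred R} := rdvd a.

Lemma principal_ideal_closed a : zmod_closed (principal_ideal a).
Proof.
split=> [|x y /asboolP[c ->] /asboolP[d ->]]; apply/asboolP.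
  by exists 0; rewrite mul0r.
by exists (c - d); rewrite mulrBl.
Qed.

HB.instance Definition _ a :=
  GRing.isZmodClosed.Build R (principal_ideal a) (principal_ideal_closed a).

Definition quot_principal a : Type := Quotient.quot (principal_ideal a).

End Divisibility.

(* The library makes the quotient by an additive subgroup a zmodType; the
   R-module structure on R/<a> is added here, with r *: \pi x = \pi (r * x).
   For a = 0 or a a unit, this is still R/<a>. *)
Section QuotientModule.
Variables (R : idomainType) (a : R).
Local Notation Q := (quot_principal a).

HB.instance Definition _ := GRing.Zmodule.copy Q (Quotient.quot (principal_ideal a)).
HB.instance Definition _ := EqQuotient.copy Q (Quotient.quot (principal_ideal a)).

Definition quot_scale (r : R) : Q -> Q := lift_op1 Q ( *%R r).

Lemma quot_principalE (x y : R) : (\pi_Q x == \pi_Q y) = rdvd a (x - y).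
Proof. by rewrite -[LHS](@Quotient.idealrBE R (principal_ideal a)). Qed.

Lemma quot_principalD (x y : R) : \pi_Q (x + y) = \pi_Q x + \pi_Q y.
Proof. exact: (@Quotient.pi_add R (principal_ideal a)). Qed.

Lemma quot_scaleE (r x : R) : quot_scale r (\pi_Q x) = \pi_Q (r * x).
Proof.
unlock quot_scale; apply/eqP; rewrite quot_principalE -mulrBr.
have : \pi_Q (repr (\pi_Q x)) == \pi_Q x by rewrite reprK.
rewrite quot_principalE => /asboolP[c ->].
by apply/asboolP; exists (r * c); rewrite mulrA.
Qed.

Lemma quot_scaleA r s x : quot_scale r (quot_scale s x) = quot_scale (r * s) x.
Proof. by rewrite -[x]reprK !quot_scaleE mulrA. Qed.

Lemma quot_scale1 : left_id 1 quot_scale.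
Proof. by move=> x; rewrite -[x]reprK quot_scaleE mul1r. Qed.

Lemma quot_scaleDr : right_distributive quot_scale +%R.
Proof.
move=> r x y; rewrite -[x]reprK -[y]reprK.
by rewrite -quot_principalD !quot_scaleE mulrDr quot_principalD.
Qed.

Lemma quot_scaleDl x : {morph quot_scale^~ x : r s / r + s}.
Proof.
by move=> r s; rewrite -[x]reprK !quot_scaleE mulrDl quot_principalD.
Qed.

HB.instance Definition _ := GRing.Zmodule_isLmodule.Build R Q
  quot_scaleA quot_scale1 quot_scaleDr quot_scaleDl.

End QuotientModule.

Section InvariantFactors.
Variable R : idomainType.

(* R/<a_1> (+) (... (+) (R/<a_m> (+) R^n)) for s = [:: a_1; ...; a_m], with
   row vectors as R^n and the componentwise module structure on pairs. *)
Fixpoint elementary_module (n : nat) (s : seq R) : lmodType R :=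
  if s is a :: s' then (quot_principal a * elementary_module n s')%type
  else 'rV[R]_n.

Definition invariant_decomposition (M : lmodType R) (n : nat) (s : seq R) :
    Prop :=
  [/\ {in s, forall a, a != 0 /\ a \isn't a GRing.unit},
      sorted (@rdvd R) s &
      exists f : {linear M -> elementary_module n s}, bijective f].

(* By the fundamental theorem of finitely generated modules over a PID, exactly
   one n satisfies [betti_number M n], and the elements satisfying
   [invariant_factor M] are the invariant factors and their associates. *)
Definition betti_number (M : lmodType R) (n : nat) : Prop :=
  exists s, invariant_decomposition M n s.

Definition invariant_factor (M : lmodType R) (a : R) : Prop :=
  exists n s, invariant_decomposition M n s /\ a \in s.

End InvariantFactors.

(* Main.v *)
From HB Require Import structures.
Require Import Defs.
From mathcomp Require Import all_boot all_order all_algebra ring.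
From mathcomp Require Import boolp classical_sets.

(* If f : M -> R/<a> is onto and p^2 divides a, with p a nonzero nonunit, then
   f^-1(p R/<a>) is a proper essential submodule: it contains p M, and
   p x = 0 forces f x into p R/<a>. This covers the non-square-free invariant
   factors and, with a = 0, the free part. Conversely, if a square-free b <> 0
   annihilates M, then M has no proper essential submodule E: a prime divisor p
   of the order of a nonzero class of M/E yields y outside E with p y = 0, and
   R y is then a nonzero submodule meeting E trivially. The invariant
   decomposition itself comes from a presentation of M: among all
   (v U)_00, with v a relation and U an invertible matrix, one that generates an
   ideal maximal among theirs divides every entry of every relation in the coordinates given
   by U, and splits off a cyclic summand. *)

Set Implicit Arguments.
Unset Strict Implicit.
Unset Printing Implicit Defensive.

Import GRing.Theory.
Local Open Scope ring_scope.
Local Open Scope quotient_scope.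

(** * Submodules as sets of elements *)

Section Submodules.
Variables (R : nzRingType) (M : lmodType R).
Implicit Types (N : set M) (u v : M) (a : R).

Lemma submoduleP N :
  submodule N <-> N 0 /\ (forall a u v, N u -> N v -> N (a *: u + v)).
Proof.
split=> [[N0 Nlin]|[N0 Nlin]].
  split=> [|a u v Nu Nv]; first by move: N0; rewrite inE.
  have : a *: u + v \in mem N by apply: Nlin; rewrite inE.
  by rewrite inE.
split=> [|a u v]; first by rewrite inE.
by rewrite !inE; exact: Nlin.
Qed.

Lemma submodule0 N : submodule N -> N 0.
Proof. by case/submoduleP. Qed.

Lemma submoduleD N u v : submodule N -> N u -> N v -> N (u + v).
Proof. by case/submoduleP=> _ Nlin Nu Nv; rewrite -[u]scale1r; apply: Nlin. Qed.

Lemma submoduleZ N a u : submodule N -> N u -> N (a *: u).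
Proof.
by case/submoduleP=> N0 Nlin Nu; rewrite -[_ *: _]addr0; apply: Nlin.
Qed.

Lemma submoduleB N u v : submodule N -> N u -> N v -> N (u - v).
Proof.
by move=> sN Nu Nv; rewrite -scaleN1r; apply: submoduleD => //; apply: submoduleZ.
Qed.

Lemma nonzero_submodule N :
  submodule N -> N <> [set 0]%classic <-> exists2 x, N x & x != 0.
Proof.
move=> sN; split=> [Nn0|[x Nx x0] N0]; last first.
  by move: Nx x0; rewrite N0 /= => ->; rewrite eqxx.
apply: contrapT => /forall2NP nN; apply: Nn0; apply/seteqP.
split=> [x Nx|x ->]; last exact: submodule0.
by have [/(_ Nx)[]|/negP] := nN x; rewrite negbK => /eqP.
Qed.

End Submodules.

(** * Divisibility, Bezout relations and primes in a principal ideal domain *)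

Section Divisibility.
Variable R : idomainType.
Implicit Types a b c d p x y : R.

Lemma rdvdP x y : reflect (exists c, y = c * x) (rdvd x y).
Proof. exact: asboolP. Qed.

Lemma rdvd_refl x : rdvd x x.
Proof. by apply/rdvdP; exists 1; rewrite mul1r. Qed.

Lemma rdvd_trans : transitive (@rdvd R).
Proof.
move=> y x z /rdvdP[c ->] /rdvdP[d ->].
by apply/rdvdP; exists (d * c); rewrite mulrA.
Qed.

Lemma rdvd_mull c x y : rdvd x y -> rdvd x (c * y).
Proof. by move=> /rdvdP[d ->]; apply/rdvdP; exists (c * d); rewrite mulrA. Qed.

Lemma rdvd_mulr c x y : rdvd x y -> rdvd x (y * c).
Proof. by rewrite mulrC; exact: rdvd_mull. Qed.

Lemma rdvdD x y z : rdvd x y -> rdvd x z -> rdvd x (y + z).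
Proof.
by move=> /rdvdP[c ->] /rdvdP[d ->]; apply/rdvdP; exists (c + d); rewrite mulrDl.
Qed.

Lemma rdvdB x y z : rdvd x y -> rdvd x z -> rdvd x (y - z).
Proof.
by move=> /rdvdP[c ->] /rdvdP[d ->]; apply/rdvdP; exists (c - d); rewrite mulrBl.
Qed.

Lemma rdvd0 x : rdvd x 0.
Proof. by apply/rdvdP; exists 0; rewrite mul0r. Qed.

Lemma rdvd0l x : rdvd 0 x = (x == 0).
Proof.
apply/idP/eqP=> [/rdvdP[c ->]|->]; [exact: mulr0 | exact: rdvd0].
Qed.

Lemma rdvd_unit x y : y \is a GRing.unit -> rdvd x y -> x \is a GRing.unit.
Proof. by move=> uy /rdvdP[c cx]; move: uy; rewrite cx unitrM => /andP[]. Qed.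

Lemma unit_rdvd x y : x \is a GRing.unit -> rdvd x y.
Proof. by move=> ux; apply/rdvdP; exists (y / x); rewrite mulrVK. Qed.

Hypothesis hPID : is_PID R.

(** The combinations [c * a + d * b] form an ideal, and [g] is a generator of it. *)
Lemma Bezout a b :
  exists g, [/\ rdvd g a, rdvd g b & exists c d, g = c * a + d * b].
Proof.
have [|g gE] := hPID (I := [set x | exists c d, x = c * a + d * b]%classic).
  apply/submoduleP; split; first by exists 0, 0; rewrite !mul0r addr0.
  move=> r _ _ [c [d ->]] [c' [d' ->]]; exists (r * c + c'), (r * d + d').
  by rewrite /GRing.scale /=; ring.
have gP x : rdvd g x <-> exists c d, x = c * a + d * b.
  by have := congr1 (fun A => A x) gE => /= ->.
exists g; split; last by apply/gP; exact: rdvd_refl.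
  by apply/gP; exists 1, 0; rewrite mul1r mul0r addr0.
by apply/gP; exists 0, 1; rewrite mul1r mul0r add0r.
Qed.

(* The maximal condition on the principal ideals (x), x in S. *)
Lemma rdvd_minimal (S : R -> Prop) : (exists x, S x) ->
  exists2 c, S c & forall b, S b -> rdvd b c -> rdvd c b.
Proof.
move=> [x0 Sx0]; apply: contrapT => noc.
have /choice[h hP] c : exists b, S c -> [/\ S b, rdvd b c & ~~ rdvd c b].
  (* Outside [S], 0 is a default value that makes [h] total. *)
  have [Sc|nSc] := pselect (S c); last by exists 0.
  apply: contrapT => /forallNP nb; apply: noc; exists c => // b Sb bc.
  by apply/negPn/negP=> ncb; apply: (nb b).
pose x n := iter n h x0.
have xS n : S (x n) by elim: n => //= n /hP[].
have x_anti m n : rdvd (x (m + n)%N) (x n).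
  elim: m => [|m IH]; first exact: rdvd_refl.
  by have [_ + _] := hP _ (xS (m + n)%N) => /rdvd_trans; apply.
(* The ideals of the [x n] increase, so their union is an ideal. Its generator [a] is a multiple of
   some [x n] and divides [x n.+1], so the chain is not strict at [n]. *)
have [|a aE] := hPID (I := [set y | exists n, rdvd (x n) y]%classic).
  apply/submoduleP; split=> [|r u v [m mu] [n nv]].
    by exists 0%N; exact: rdvd0.
  exists (m + n)%N; apply: rdvdD.
    by apply: rdvd_mull; apply: rdvd_trans mu; rewrite addnC.
  exact: rdvd_trans nv.
have aP y : rdvd a y <-> exists n, rdvd (x n) y.
  by have := congr1 (fun A => A y) aE => /= ->.
have [n na] := (aP a).1 (rdvd_refl a).
have an : rdvd a (x n.+1) by apply/aP; exists n.+1; exact: rdvd_refl.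
by have [_ _ /negP] := hP _ (xS n); apply; exact: rdvd_trans an.
Qed.

(** A nonunit divisor [p] of [d] whose ideal is maximal is prime: a gcd of [p] and [x] is either a
    nonunit, which [p] then divides, or a unit, and then a Bezout relation gives the divisibility of
    [y]. *)
Lemma prime_divisor d : d != 0 -> d \isn't a GRing.unit ->
  exists2 p, prime_elt p & rdvd p d.
Proof.
move=> d0 dU.
have [|p [pU pd] pmin] :=
    @rdvd_minimal (fun x => x \isn't a GRing.unit /\ rdvd x d).
  by exists d; split=> //; exact: rdvd_refl.
exists p => //; split=> // [|x y /rdvdP[e xye]].
  by apply: contraNneq d0 => p0; rewrite p0 rdvd0l in pd.
have [g [gp gx [c [b gE]]]] := Bezout p x.
have [gU|gU] := boolP (g \is a GRing.unit); last first.
  left; apply: rdvd_trans gx; apply: pmin => //.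
  by split=> //; exact: rdvd_trans pd.
(* From [g = c * p + b * x] and [x * y = e * p] follows [g * y = (c * y + b * e) * p], with [g]
   invertible. *)
right; apply/rdvdP; exists (g^-1 * (c * y + b * e)).
have -> : g^-1 * (c * y + b * e) * p = g^-1 * (c * p * y + b * (e * p)) by ring.
by rewrite -xye mulrA -mulrDl -gE mulKr.
Qed.

(** Write [p = q * g] with [g] a gcd of [p] and [x]. By primality [p] divides [q], which makes [g] a
    unit, or [g], and then it would divide [x]. *)
Lemma Bezout_prime p x : prime_elt p -> ~~ rdvd p x ->
  exists c d, 1 = c * p + d * x.
Proof.
move=> [p0 pU pP] px; have [g [/rdvdP[q pE] gx [c [d gE]]]] := Bezout p x.
have [|/rdvdP[e qE]|/rdvdP[e gE']] := pP q g.
- by rewrite -pE; exact: rdvd_refl.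
- have eg1 : e * g = 1.
    by apply: (mulfI p0); rewrite mulr1 [RHS]pE {1}qE; ring.
  by exists (e * c), (e * d); rewrite -eg1 gE; ring.
- by case/negP: px; apply: rdvd_trans gx; apply/rdvdP; exists e.
Qed.

End Divisibility.

(** * Existence of the invariant decomposition *)

Section Structure.
Variable R : idomainType.
Implicit Types a b c d : R.

Lemma quot_principal_eq0 a x : (\pi_(quot_principal a) x == 0) = rdvd a x.
Proof.
rewrite -[in RHS](subr0 x) -quot_principalE; congr (_ == _).
by rewrite -(mul0r 0) -quot_scaleE; apply/esym/scale0r.
Qed.

Lemma rdvd_mulmx d m n p (x : 'M[R]_(m, n)) (U : 'M_(n, p)) i j :
  (forall l, rdvd d (x i l)) -> rdvd d ((x *m U) i j).
Proof.
move=> dx; rewrite mxE; elim/big_ind: _ => [|? ?|l _].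
- exact: rdvd0.
- exact: rdvdD.
- exact: rdvd_mulr.
Qed.

Hypothesis hPID : is_PID R.

(** Induction on the length: [V] brings a gcd [h] of the tail to its front, and a unimodular
    operation on the first two entries then turns [a] and [h] into their gcd. *)
Lemma unimodular_gcd k (x : 'rV[R]_(1 + k)) :
  exists2 U, U \in unitmx & forall j, rdvd ((x *m U) 0 0) (x 0 j).
Proof.
elim: k x => [|k IH] x.
  exists 1%:M => [|j]; first exact: unitmx1.
  by rewrite mulmx1 !ord1 rdvd_refl.
pose a := x 0 0; pose y : 'rV_(1 + k) := rsubmx (x : 'rV_(1 + (1 + k))).
have [V uV yV] := IH y; pose h := (y *m V) 0 0.
pose z : 'rV_k := rsubmx (y *m V).
have xE : (x : 'rV_(1 + (1 + k))) = row_mx a%:M y.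
  rewrite -[LHS]hsubmxK; congr row_mx; rewrite [LHS]mx11_scalar mxE.
  by congr (x _ _)%:M; apply/val_inj.
have yVE : y *m V = row_mx h%:M z.
  rewrite -[LHS]hsubmxK; congr row_mx; rewrite [LHS]mx11_scalar mxE.
  by congr ((y *m V) _ _)%:M; apply/val_inj.
pose D : 'M_(1 + (1 + k)) := block_mx 1%:M 0 0 V.
have uD : D \in unitmx by rewrite unitmxE det_ublock det1 mul1r -unitmxE.
have xD : x *m D = row_mx a%:M (row_mx h%:M z).
  by rewrite xE -yVE mul_row_block mulmx1 !mulmx0 addr0 add0r.
have [g [/rdvdP[a' aE] /rdvdP[h' hE] [c [d gE]]]] := Bezout hPID a h.
have dvdx U : rdvd ((x *m U) 0 0) g -> forall j, rdvd ((x *m U) 0 0) (x 0 j).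
  move=> Ug j; apply: (rdvd_trans Ug); rewrite xE mxE.
  case: splitP => l _; first by rewrite !ord1 mxE eqxx aE rdvd_mull // rdvd_refl.
  by apply: rdvd_trans (yV l); rewrite -/h hE rdvd_mull // rdvd_refl.
have [g0|gn0] := eqVneq g 0.
  by exists 1%:M; [exact: unitmx1 | apply: dvdx; rewrite g0 rdvd0].
have cd1 : c * a' + d * h' = 1.
  by apply: (mulIf gn0); rewrite mul1r [RHS]gE aE hE; ring.
(* On the first two coordinates [T] has rows [c, - h'] and [d, a'], of determinant
   [c * a' + d * h' = 1]; it sends [a, h] to a pair starting with [g]. Its inverse is [T']. *)
pose T : 'M_(1 + (1 + k)) := block_mx c%:M (row_mx (- h')%:M 0)
  (col_mx d%:M 0) (block_mx a'%:M 0 0 1%:M).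
pose T' : 'M_(1 + (1 + k)) := block_mx a'%:M (row_mx h'%:M 0)
  (col_mx (- d)%:M 0) (block_mx c%:M 0 0 1%:M).
have TT' : T *m T' = 1%:M.
  rewrite /T /T' mulmx_block mulmx_block.
  rewrite mul_row_col mul_mx_row mul_row_block mul_col_mx mul_block_col mul_col_row.
  rewrite !(mulmx0, mul0mx, mulmx1, add_row_mx, add_col_mx, add_block_mx).
  rewrite !addr0 !add0r -!scalar_mxM -!raddfD.
  have -> : c * a' + - h' * - d = 1 by rewrite -cd1; ring.
  have -> : d * h' + a' * c = 1 by rewrite -cd1; ring.
  have -> : c * h' + - h' * c = 0 by ring.
  have -> : d * a' + a' * - d = 0 by ring.
  by rewrite raddf0 row_mx0 col_mx0 -!/(block_mx _ _ _ _) -!scalar_mx_block.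
have [uT _] := mulmx1_unit TT'.
have TE : lsubmx (row_mx a%:M (row_mx h%:M z) *m T) = g%:M.
  rewrite /T mul_row_block row_mxKl mul_row_col mulmx0 addr0.
  by rewrite -!scalar_mxM -raddfD gE mulrC [h * _]mulrC.
exists (D *m T); first by rewrite unitmx_mul uD.
apply: dvdx; rewrite mulmxA xD.
have := congr1 (fun A : 'M_1 => A 0 0) TE.
rewrite [RHS]mxE eqxx mxE (_ : lshift _ 0 = 0); last exact/val_inj.
by move=> ->; exact: rdvd_refl.
Qed.

Definition invariant_seq (s : seq R) : Prop :=
  {in s, forall a, a != 0 /\ a \isn't a GRing.unit} /\ sorted (@rdvd R) s.

(** Encodes that R^k / [K] is the elementary module, by a surjection with kernel [K] in place of a
    quotient type. *)
Definition quotient_map k (K : set 'rV[R]_k) n s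
    (f : 'rV[R]_k -> elementary_module n s) : Prop :=
  [/\ linear f, forall y, exists x, f x = y & forall x, f x = 0 <-> K x].

(* The last clause gives the divisibility chain: after splitting off R/<c>, all
   remaining relations have entries divisible by c. *)
Definition elementary_quotient k (K : set 'rV[R]_k) : Prop :=
  exists n s (f : 'rV[R]_k -> elementary_module n s),
  [/\ invariant_seq s, quotient_map K f &
      forall d, (forall v j, K v -> rdvd d (v 0 j)) -> all (rdvd d) s].

(** As [w] has first entry 1, R^(1+k) is the direct sum of R [w] and 0 x R^k. Since [c] divides all
    first entries in [K], the submodule [K] splits along this sum, with R [c *: w] as its first
    part; this splits off R/<c>. *)
Lemma elementary_quotient_split k (K : set 'rV[R]_(1 + k)) c (w : 'rV_(1 + k)) :
    submodule K -> w 0 0 = 1 -> K (c *: w) ->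
    (forall v j, K v -> rdvd c (v 0 j)) -> c != 0 ->
    elementary_quotient [set x : 'rV_k | K (row_mx 0 x)]%classic ->
  elementary_quotient K.
Proof.
move=> sK w1 Kw cK c0 [n [s [f [[s0 s_sorted] [flin fsurj fK] sdvd]]]].
have K'dvd d : (forall v j, K v -> rdvd d (v 0 j)) -> all (rdvd d) s.
  move=> dK; apply: sdvd => v j Kv.
  by have := dK _ (rshift 1 j) Kv; rewrite row_mxEr.
(* The projection along [w] onto the last [k] coordinates. *)
pose rho (y : 'rV_(1 + k)) : 'rV_k := rsubmx (y - y 0 0 *: w).
have rhoE y : row_mx 0 (rho y) = y - y 0 0 *: w.
  rewrite -[RHS]hsubmxK; congr row_mx; apply/rowP=> i.
  rewrite !ord1 !mxE (_ : lshift k 0 = 0); last exact/val_inj.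
  by rewrite w1 mulr1 subrr.
have rho_lin a x y : rho (a *: x + y) = a *: rho x + rho y.
  by apply/rowP=> i; rewrite !mxE; ring.
have coordD t z : (t *: w + row_mx 0 z) 0 0 = t.
  rewrite !mxE w1 mulr1 -[RHS]addr0; congr (_ + _).
  by case: splitP => // l _; rewrite mxE.
have rhoD t z : rho (t *: w + row_mx 0 z) = z.
  apply/rowP=> i; rewrite /rho coordD mxE [X in X - _]addrC addrK.
  exact: row_mxEr.
have KP (y : 'rV_(1 + k)) : rdvd c (y 0 0) /\ f (rho y) = 0 <-> K y.
  split=> [[/rdvdP[e yE] /fK]|Ky].
    rewrite /= rhoE => Ky; rewrite -[y](subrK (y 0 0 *: w)).
    by apply: submoduleD => //; rewrite yE -scalerA; apply: submoduleZ.
  have /rdvdP[e yE] := cK y 0 Ky; split; first exact: cK.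
  apply/fK; rewrite /= rhoE; apply: submoduleB => //.
  by rewrite yE -scalerA; apply: submoduleZ.
(* For a unit [c] the summand R/<c> is zero and must be left out, since invariant factors are
   nonunits. *)
have [cU|cU] := boolP (c \is a GRing.unit).
  exists n, s, (f \o rho); split=> //; split=> [a x y|m|y] /=.
  - by rewrite rho_lin flin.
  - have [z <-] := fsurj m; exists (0 *: w + row_mx 0 z).
    by rewrite rhoD.
  - by rewrite -KP; split=> [|[]//]; split=> //; exact: unit_rdvd.
pose F (y : 'rV_(1 + k)) : elementary_module n (c :: s) :=
  (\pi_(quot_principal c) (y 0 0), f (rho y)).
exists n, (c :: s), F; split.
- split=> [a|].
    by rewrite inE => /predU1P[->|/s0].
  by rewrite /= (path_sortedE (@rdvd_trans R)) s_sorted andbT; apply: K'dvd.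
- split=> [a x y|[q m]|y].
  + by rewrite /F rho_lin flin !mxE quot_principalD -quot_scaleE.
  + have [z <-] := fsurj m; exists (repr q *: w + row_mx 0 z).
    by rewrite /F rhoD coordD reprK.
  + rewrite -KP -quot_principal_eq0.
    by split=> [[-> ->]|[/eqP q0 f0]]; rewrite // /F q0 f0.
- move=> d dK; rewrite /= K'dvd // andbT.
  by have := dK _ 0 Kw; rewrite mxE w1 mulr1.
Qed.

Lemma submodule_quotient k (K : set 'rV[R]_k) :
  submodule K -> elementary_quotient K.
Proof.
have id_quotient l (L : set 'rV[R]_l) :
    (forall x, L x -> x = 0) -> L 0 -> elementary_quotient L.
  move=> L0 L00; exists l, [::], (id : 'rV_l -> elementary_module l [::]).
  by split=> //; split=> // [y|x]; [exists y|split=> [->|/L0]].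
elim: k K => [|k IH] K sK.
  by apply: id_quotient => [x _|]; [exact: thinmx0 | exact: submodule0].
pose S c := exists v (U : 'M_(1 + k)), [/\ K v, U \in unitmx & c = (v *m U) 0 0].
have [|c [v0 [U [Kv0 uU cE]]] cmin] := rdvd_minimal hPID (S := S).
  exists 0, 0, 1%:M; split; [exact: submodule0|exact: unitmx1|].
  by rewrite mul0mx mxE.
pose L : set 'rV[R]_(1 + k) := [set x | K (x *m invmx U)]%classic.
have sL : submodule L.
  apply/submoduleP; split=> [|a x y]; rewrite /L /= ?mul0mx.
    exact: submodule0.
  by rewrite mulmxDl -scalemxAl => Kx Ky; apply: submoduleD => //; apply: submoduleZ.
have LU x : K x <-> L (x *m U) by rewrite /L /= mulmxK.
suff [n [s [f [sP [flin fsurj fL] sdvd]]]] : elementary_quotient L.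
  exists n, s, (fun x => f (x *m U)); split=> //.
    split=> [a x y|y|x].
    - by rewrite mulmxDl -scalemxAl flin.
    - by have [x <-] := fsurj y; exists (x *m invmx U); rewrite mulmxKV.
    - by rewrite fL LU.
  move=> d dK; apply: sdvd => v j Kv; rewrite -[v](mulmxKV uU).
  by apply: rdvd_mulmx => i; apply: dK.
have [v Lv vc] : exists2 v, L v & v 0 0 = c.
  by exists (v0 *m U) => //; apply/(LU v0).
have vmin x : L x -> rdvd (x 0 0) c -> rdvd c (x 0 0).
  move=> Lx; apply: cmin; exists (x *m invmx U), U.
  by split=> //; rewrite mulmxKV.
(* A gcd of the entries of [x] again lies in [S], and it divides [c]. *)
have v_dvd x : L x -> x 0 0 = c -> forall j, rdvd c (x 0 j).
  move=> Lx xc j; have [V uV xV] := unimodular_gcd x.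
  apply: rdvd_trans (xV j); apply: cmin; last by rewrite -xc; exact: xV.
  exists (x *m invmx U), (U *m V); split=> //; first by rewrite unitmx_mul uU.
  by rewrite mulmxA mulmxKV.
(* A gcd of [c] and [x 0 0] is the first entry of a combination of [v] and [x], so minimality of [c]
   applies to it. *)
have L0dvd x : L x -> rdvd c (x 0 0).
  move=> Lx; have [g [gc gx [a [b gE]]]] := Bezout hPID c (x 0 0).
  have yE : (a *: v + b *: x) 0 0 = g by rewrite !mxE gE vc.
  apply: rdvd_trans gx; rewrite -yE; apply: vmin; last by rewrite yE.
  by apply: submoduleD => //; apply: submoduleZ.
have Ldvd x j : L x -> rdvd c (x 0 j).
  move=> Lx; have /rdvdP[e xE] := L0dvd x Lx.
  (* congruent to x modulo c, with first entry exactly c *)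
  have Ly : L (x + (1 - e) *: v) by apply: submoduleD => //; apply: submoduleZ.
  have := v_dvd _ Ly; rewrite !mxE xE vc.
  rewrite (_ : e * c + (1 - e) * c = c); last by ring.
  move=> /(_ erefl j); rewrite !mxE => /rdvdB.
  move=> /(_ ((1 - e) * v 0 j)); rewrite addrK; apply.
  by apply: rdvd_mull; apply: v_dvd.
(* If [c = 0], the only relation is 0 and the quotient is free. *)
have [c0|c0] := eqVneq c 0.
  apply: id_quotient; last exact: submodule0.
  move=> x Lx; apply/rowP=> j; rewrite mxE; apply/eqP.
  by rewrite -rdvd0l -c0; exact: Ldvd.
have /choice[w wE] j : exists a, v 0 j = a * c by apply/rdvdP/Ldvd.
apply: (@elementary_quotient_split _ _ c (\row_j w j)) => //.
- by apply: (mulIf c0); rewrite mxE -wE mul1r vc.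
- suff -> : c *: (\row_j w j) = v by [].
  by apply/rowP=> j; rewrite !mxE mulrC -wE.
- apply: IH; apply/submoduleP; split=> [|a x y] /=.
    by rewrite row_mx0; exact: submodule0.
  move=> Lx Ly; rewrite -[0](scaler0 _ a) -{1}[a *: 0]addr0 -add_row_mx -scale_row_mx.
  by apply: submoduleD => //; apply: submoduleZ.
Qed.

Lemma invariant_decomposition_exists (M : lmodType R) :
  finitely_generated M -> exists n s, invariant_decomposition M n s.
Proof.
move=> [k [g gM]].
pose phi (x : 'rV[R]_k) : M := \sum_(i < k) x 0 i *: g i.
have phi_lin a x y : phi (a *: x + y) = a *: phi x + phi y.
  rewrite /phi scaler_sumr -big_split; apply: eq_bigr => i _.
  by rewrite !mxE scalerDl scalerA.
have /choice[h hP] m : exists x, phi x = m.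
  have [x ->] := gM m; exists (\row_i x i).
  by apply: eq_bigr => i _; rewrite mxE.
have [|n [s [f [[s0 s_sorted] [flin fsurj fK] _]]]] :=
    @submodule_quotient _ [set x | phi x = 0]%classic.
  apply/submoduleP; split=> [|a x y /= x0 y0].
    by apply: big1 => i _; rewrite mxE scale0r.
  by rewrite phi_lin x0 y0 scaler0 addr0.
(* [f] and [phi] have the same kernel, so [f \o h] does not depend on the chosen preimages. Once
   proved, this fact shadows the library's [eqP]. *)
have eqP x y : f x = f y <-> phi x = phi y.
  have -> : (f x = f y) <-> f (x - y) = 0.
    rewrite addrC -scaleN1r flin scaleN1r addrC.
    by split=> [->|/eqP]; rewrite ?subrr // subr_eq0 => /eqP.
  rewrite fK /= addrC -scaleN1r phi_lin scaleN1r addrC.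
  by split=> [/eqP|->]; rewrite ?subrr // subr_eq0 => /eqP.
have /choice[r rP] := fsurj.
have Flin : linear (f \o h).
  by move=> a x y /=; rewrite -flin; apply/eqP; rewrite phi_lin !hP.
pose F : {linear M -> elementary_module n s} :=
  HB.pack (f \o h) (GRing.isLinear.Build _ _ _ _ _ Flin).
exists n, s; split=> //; exists F; exists (phi \o r) => [m|y] /=.
  by rewrite -[RHS]hP; apply/eqP; rewrite rP.
by rewrite -[RHS]rP; apply/eqP; rewrite hP.
Qed.

End Structure.

(** * Essential submodules: construction from cyclic quotients, obstruction by a square-free
    annihilator *)

Section EssentialSubmodules.
Variable R : idomainType.
Implicit Types (a b p : R) (M : lmodType R).

Definition cyclic_quotient M a : Prop :=
  exists f : M -> quot_principal a, linear f /\ forall y, exists x, f x = y.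

Lemma cyclic_quotient_comp M (N : lmodType R) a (g : M -> N) :
  linear g -> (forall y, exists x, g x = y) ->
  cyclic_quotient N a -> cyclic_quotient M a.
Proof.
move=> glin gsurj [f [flin fsurj]]; exists (f \o g); split=> [c x y|z] /=.
  by rewrite glin flin.
by have [y <-] := fsurj z; have [x <-] := gsurj y; exists x.
Qed.

Lemma elementary_module_factor n (s : seq R) a :
  a \in s -> cyclic_quotient (elementary_module n s) a.
Proof.
elim: s => // b s IH; rewrite inE => /predU1P[->|/IH].
  exists (fst : elementary_module n (b :: s) -> quot_principal b).
  by split=> // y; exists (y, 0).
apply: (@cyclic_quotient_comp (elementary_module n (b :: s)) _ _ snd) => // y.
by exists (0, y).
Qed.

Lemma elementary_module_free n (s : seq R) :
  (0 < n)%N -> cyclic_quotient (elementary_module n s) 0.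
Proof.
case: n => // n _; elim: s => [|b s].
  exists (fun x : 'rV_n.+1 => \pi_(quot_principal 0) (x 0 0)).
  split=> [c x y|y]; first by rewrite !mxE quot_principalD -quot_scaleE.
  by exists (const_mx (repr y)); rewrite mxE reprK.
apply: (@cyclic_quotient_comp (elementary_module n.+1 (b :: s)) _ _ snd) => // y.
by exists (0, y).
Qed.

Lemma cyclic_quotient_essential M a p :
    p != 0 -> p \isn't a GRing.unit -> rdvd (p ^+ 2) a -> cyclic_quotient M a ->
  exists E : set M, proper_essential_submodule E.
Proof.
move=> p0 pU /rdvdP[c aE] [f [flin fsurj]].
have f0 : f 0 = 0 by have := flin (-1) 0 0; rewrite !scaleN1r !addNr.
have fZ r x : f (r *: x) = r *: f x by rewrite -[r *: x]addr0 flin f0 addr0.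
pose E : set M := [set x | exists r, f x = \pi_(quot_principal a) (p * r)]%classic.
have sE : submodule E.
  apply/submoduleP; split=> [|r x y [u xu] [v yv]].
    exists 0; rewrite f0; apply/esym/eqP.
    by rewrite quot_principal_eq0 mulr0 rdvd0.
  exists (r * u + v); rewrite flin xu yv [_ *: _]quot_scaleE -quot_principalD.
  by congr (\pi _); ring.
have Ep x : E (p *: x).
  by exists (repr (f x)); rewrite fZ -[in LHS](reprK (f x)); apply: quot_scaleE.
(* Here [a], hence [p ^+ 2], divides [p * r]; cancelling [p] shows that [p] divides [r]. *)
have dvdP x r : f x = \pi r -> p *: x = 0 -> E x.
  move=> xr px0; have /eqP : f (p *: x) = 0 by rewrite px0.
  rewrite fZ xr [_ *: _]quot_scaleE quot_principal_eq0 => /rdvdP[d prE].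
  exists (d * c); rewrite xr; congr (\pi _).
  by apply: (mulfI p0); rewrite prE aE; ring.
have p_neq1 u : 1 <> p * u.
  by move=> pu1; case/negP: pU; apply/unitrPr; exists u.
have [e fe] := fsurj (\pi 1).
exists E; split=> //.
- apply/nonzero_submodule => //; exists (p *: e); first exact: Ep.
  apply/negP => /eqP pe0.
  have /eqP : f (p *: e) = 0 by rewrite pe0.
  rewrite fZ fe [_ *: _]quot_scaleE quot_principal_eq0 mulr1 => /rdvdP[d pE].
  by apply: (p_neq1 (d * c)); apply: (mulIf p0); rewrite {1}pE aE; ring.
- move=> ET; have : E e by rewrite ET.
  move=> [r /eqP]; rewrite fe quot_principalE => /rdvdP[d].
  rewrite aE => /(canRL (subrK _)) h1; apply: (p_neq1 (d * c * p + r)).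
  by rewrite h1; ring.
(* [p *: x] lies in both [E] and [N]; if it vanishes, [x] itself does. *)
- move=> N sN /(nonzero_submodule sN)[x Nx x0] EN0.
  have EN y : E y -> N y -> y = 0.
    by move=> Ey Ny; have : (E `&` N)%classic y by []; rewrite EN0.
  have px0 : p *: x = 0 by apply: EN; [exact: Ep | exact: submoduleZ].
  have Ex : E x by apply: (dvdP x (repr (f x))) => //; rewrite reprK.
  by move/eqP: x0; apply; exact: EN.
Qed.

Lemma elementary_module_annihilator (s : seq R) b :
  all (fun a => rdvd a b) s -> forall x : elementary_module 0 s, b *: x = 0.
Proof.
elim: s => [_ x|a s IH /= /andP[ab /IH sb] [q x]]; first exact: thinmx0.
apply: injective_projections; last exact: sb.
rewrite /= -[q]reprK [LHS]quot_scaleE; apply/eqP.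
by rewrite quot_principal_eq0 rdvd_mulr.
Qed.

Lemma sorted_rdvd_last (s : seq R) x0 :
  sorted (@rdvd R) s -> all (fun a => rdvd a (last x0 s)) s.
Proof.
case: s => //= a s; elim: s a => [|b s IH] a /=; first by rewrite rdvd_refl.
by move=> /andP[ab /IH /andP[bs ->]]; rewrite bs (rdvd_trans ab bs).
Qed.

Lemma square_free_annihilator M b : is_PID R -> b != 0 -> square_free b ->
  (forall x : M, b *: x = 0) -> ~ exists E : set M, proper_essential_submodule E.
Proof.
move=> hPID b0 b_sqf bM [E [sE _ ET Eess]].
have [x nEx] : exists x, ~ E x.
  apply: contrapT => /forallNP nE; apply: ET; rewrite -subTset => x _.
  exact: contrapT (nE x).
(* [d] generates the annihilator of the class of [x] in [M]/[E]. *)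
have [|d dE] := hPID [set r | E (r *: x)]%classic.
  apply/submoduleP; split=> [|r u v Eu Ev] /=.
    by rewrite scale0r; exact: submodule0.
  rewrite scalerDl -scalerA.
  by apply: submoduleD => //; apply: submoduleZ.
have dP r : rdvd d r <-> E (r *: x).
  by have := congr1 (fun A => A r) dE => /= ->.
have db : rdvd d b by apply/dP; rewrite bM; exact: submodule0.
have d0 : d != 0 by apply: contraNneq b0 => d0; rewrite -rdvd0l -d0.
have dU : d \isn't a GRing.unit.
  apply/negP => dU; apply: nEx.
  by rewrite -[x]scale1r; apply/dP/unit_rdvd.
have [p p_prime /rdvdP[q dq]] := prime_divisor hPID d0 dU.
have [p0 pU _] := p_prime.
have [e be] : exists e, b = p * e.
  by have /rdvdP[c ->] := db; exists (c * q); rewrite dq; ring.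
have npe : ~~ rdvd p e.
  apply: contra (b_sqf p p_prime) => /rdvdP[c ec].
  by apply/rdvdP; exists c; rewrite be ec; ring.
have nEq : ~ E (q *: x).
  move=> /dP /rdvdP[c qc]; case/negP: pU; apply/unitrPr; exists c.
  have q0 : q != 0 by apply: contraNneq d0 => q0; rewrite dq q0 mul0r.
  by apply: (mulfI q0); rewrite mulr1 {2}qc dq; ring.
have Epq : E (p *: (q *: x)).
  by rewrite scalerA mulrC -dq; apply/dP; exact: rdvd_refl.
have [u [v uv1]] := Bezout_prime hPID p_prime npe.
(* By [1 = u * p + v * e], [y] is congruent to [q *: x] modulo [E]; the factor [e] gives
   [p *: y = 0], because [p * e = b] kills [M]. *)
pose y := (v * e) *: (q *: x).
have nEy : ~ E y.
  move=> Ey; apply: nEq; rewrite -[q *: x]scale1r uv1 scalerDl.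
  by apply: submoduleD => //; rewrite -scalerA; apply: submoduleZ.
have py0 : p *: y = 0.
  by rewrite /y !scalerA (_ : _ * q = (v * q) * b) -?scalerA ?bM ?scaler0 // be; ring.
have sN : submodule [set z | exists r, z = r *: y]%classic.
  apply/submoduleP; split=> [|r _ _ [c ->] [c' ->]].
    by exists 0; rewrite scale0r.
  by exists (r * c + c'); rewrite scalerDl scalerA.
apply: (Eess _ sN).
  apply/(nonzero_submodule sN); exists y; first by exists 1; rewrite scale1r.
  by apply: contra_not_neq nEy => ->; exact: submodule0.
apply/seteqP; split=> [z /= [Ez [r zr]]|_ ->] /=; last first.
  by split; [exact: submodule0 | exists 0; rewrite scale0r].
(* If [p] divides [r], then [z = r *: y] is 0; otherwise [r] is invertible modulo [p], and [y] would
   be a multiple of [z], hence in [E]. *)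
have [/rdvdP[c rc]|npr] := boolP (rdvd p r).
  by rewrite zr rc -scalerA py0 scaler0.
have [c [c' cc1]] := Bezout_prime hPID p_prime npr.
case: nEy; rewrite -[y]scale1r cc1 scalerDl -!scalerA py0 scaler0 add0r -zr.
exact: submoduleZ.
Qed.

End EssentialSubmodules.

Theorem theorem2p4 (R : idomainType) (hPID : is_PID R)
    (hnotfield : ~ GRing.field_axiom R)
    (M : lmodType R) (hfg : finitely_generated M) :
  (exists E : set M, proper_essential_submodule E) <->
  (exists2 n : nat, betti_number M n & (1 <= n)%N) \/
  (exists2 a : R, invariant_factor M a & ~ square_free a).
Proof.
have transfer n s a : invariant_decomposition M n s ->
    cyclic_quotient (elementary_module n s) a -> cyclic_quotient M a.
  move=> [_ _ [f [g fK gK]]]; apply: cyclic_quotient_comp (linearP f) _.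
  by move=> y; exists (g y); rewrite gK.
split=> [Mess|[[n [s Mdec] n_gt0]|[a [n [s [Mdec sa]]] a_nsqf]]].
- apply: contrapT => /not_orP[nbetti nfactor].
  have [n [s Mdec]] := invariant_decomposition_exists hPID hfg.
  have n0 : n = 0%N.
    by case: n Mdec => // n Mdec; case: nbetti; exists n.+1 => //; exists s.
  rewrite {}n0 in Mdec; have [s0 s_sorted [f fbij]] := Mdec.
  have s_sqf a : a \in s -> square_free a.
    by move=> sa; apply: contrapT => nsqf; apply: nfactor; exists a => //;
      exists 0%N, s.
  (* The last invariant factor is a multiple of all others and so annihilates [M]; for empty [s] the
     default 1 annihilates [M = 0]. *)
  have s_last := mem_last 1 s.
  have [b0 b_sqf] : last 1 s != 0 /\ square_free (last 1 s).
    move: s_last; rewrite inE => /predU1P[->|sl]; last first.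
      by split; [have [] := s0 _ sl | exact: s_sqf].
    split=> [|p [_ pU _]]; first exact: oner_neq0.
    by apply: contra pU => /(rdvd_unit (unitr1 _)); rewrite unitrX_pos.
  apply: (square_free_annihilator hPID b0 b_sqf _ Mess) => x.
  apply: (bij_inj fbij); rewrite linearZ linear0.
  exact: (elementary_module_annihilator (sorted_rdvd_last 1 s_sorted)).
(* As R is not a field, it has a nonzero nonunit [p], and [p ^+ 2] divides 0. *)
- have [p [p0 pU]] : exists p : R, p != 0 /\ p \isn't a GRing.unit.
    apply: contrapT => /forallNP np; apply: hnotfield => p p0.
    by apply: contrapT => /negP pU; apply: (np p).
  apply: (cyclic_quotient_essential p0 pU (rdvd0 _)).
  exact/(transfer n s)/elementary_module_free.
- have [p [[p0 pU _] pa]] : exists p, prime_elt p /\ rdvd (p ^+ 2) a.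
    apply: contrapT => /forallNP np; apply: a_nsqf => p p_prime.
    by apply/negP => pa; apply: (np p).
  apply: (cyclic_quotient_essential p0 pU pa).
  exact/(transfer n s)/elementary_module_factor.
Qed.
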